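(* Let $A$ be a $1 \times n$ real matrix, let $\sigma:\mathbb{R}\to\mathbb{R}$ be a weakly monotone continuous function and let $f=\sigma \circ A : \mathbb{R}^n \to \mathbb{R}$, $x \mapsto \sigma(Ax)$. Assume that $\sigma$ is of the form $$\sigma(x) = \begin{cases} 0 & \text{if } -\infty < x \leq a,\\ h(x) & \text{if } x > a, \end{cases}$$ with $a \in \mathbb{R}$ and $h:(a,+\infty)\to\mathbb{R}$ a differentiable, strictly increasing function such that $\lim_{x\to a^+}h(x)=0$ and $\lim_{x\to a^+}h'(x)=\ell$ for some $\ell \in \mathbb{R}$, $\ell \neq 0$. Let $\gamma:[c,d]\rightarrow\mathbb{R}^n$ be a null curve. Then two points $p,q$ belonging to different equivalence classes of $f$ cannot both belong to $\mathrm{Im}(\gamma)$. The same result holds when $h$ is strictly decreasing instead of strictly increasing.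
   Context: The equivalence classes of $f$ are those of the relation on $\mathbb{R}^n$ defined by $p \sim q$ if and only if $f(p)=f(q)$. Weakly monotone means non-decreasing or non-increasing. Standing assumption in the paper: activation functions are almost-everywhere $\mathcal{C}^1$, that is, continuous, and $\mathcal{C}^1$ outside a set of measure zero. With $g$ the standard metric on $\mathbb{R}$, the pullback $f^*g$ is defined at the points $x$ where $f$ is differentiable, and is the bilinear form with matrix $(f^*g)_{ij}(x) = \frac{\partial f}{\partial x_i}(x)\,\frac{\partial f}{\partial x_j}(x)$. A null curve is a piecewise $\mathcal{C}^1$ curve $\gamma:[c,d]\to\mathbb{R}^n$ such that $\dot\gamma(s) \in \mathrm{Ker}\big((f^*g)_{\gamma(s)}\big)$ for every $s$ (other than the finitely many break points of $\gamma$) at which $f^*g$ is defined at $\gamma(s)$. *)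

(* Defs.v *)
From mathcomp Require Export all_boot all_order all_algebra.
From mathcomp Require Export all_classical all_reals all_analysis.
Export numFieldNormedType.Exports.
Export Order.TTheory GRing.Theory Num.Theory.

Set Implicit Arguments.
Unset Strict Implicit.
Unset Printing Implicit Defensive.

Local Open Scope classical_set_scope.
Local Open Scope ring_scope.

Definition equiv_class (T U : Type) (f : T -> U) (p : T) : set T :=
  [set q | f p = f q].

Definition weakly_monotone (R : realType) (s : R -> R) : Prop :=
  (nondecreasing_fun s) \/ (nonincreasing_fun s).

(* The derivative is only required to be continuous as a function on the
   complement of the null set N, which need not be closed; this is implied by
   the variant where s is C^1 on an open set of full measure. *)
Definition ae_C1 (R : realType) (s : R -> R) : Prop :=
  continuous s /\
  exists N : set R,
    [/\ (@lebesgue_measure R).-negligible N,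
        forall x, ~ N x -> derivable s x 1
      & {within ~` N, continuous derive1 s}].

Definition compose_row (R : realType) (n : nat) (s : R -> R)
  (A : 'M[R]_(1, n)) : 'cV[R]_n -> R := fun x => s ((A *m x) 0 0).

(* Meaningful only where f is differentiable. *)
Definition pullback_metric (R : realType) (n : nat) (f : 'cV[R]_n -> R)
  (x : 'cV[R]_n) : 'M[R]_n :=
  \matrix_(i, j) ('D_(delta_mx i 0) f x * 'D_(delta_mx j 0) f x).

Definition bilinear_ker (R : realType) (n : nat) (G : 'M[R]_n) :
  set 'cV[R]_n := [set v | forall w : 'cV[R]_n, v^T *m G *m w = 0].

(* Differentiation relative to S, so that the derivative at an endpoint of
   a closed interval S is the one-sided one. *)
Definition derivable_within (R : realType) (n : nat) (S : set R)
  (g : R -> 'cV[R]_n) (t : R) : Prop :=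
  cvg ((fun x => (x - t)^-1 *: (g x - g t)) @ within S t^').

Definition derive_within (R : realType) (n : nat) (S : set R)
  (g : R -> 'cV[R]_n) (t : R) : 'cV[R]_n :=
  lim ((fun x => (x - t)^-1 *: (g x - g t)) @ within S t^').

Definition C1_on_itv (R : realType) (n : nat) (u v : R)
  (g : R -> 'cV[R]_n) : Prop :=
  (forall t, t \in `[u, v] -> derivable_within `[u, v] g t) /\
  {within `[u, v], continuous (derive_within `[u, v] g)}.

(* [itv_partition c d s] says that c :: s is a subdivision
   c = t_0 < t_1 < ... < t_k = d of [c, d]. *)
Definition piecewise_C1 (R : realType) (n : nat) (c d : R) (s : seq R)
  (g : R -> 'cV[R]_n) : Prop :=
  [/\ itv_partition c d s,
      {within `[c, d], continuous g}
    & forall i, (i < size s)%N ->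
        C1_on_itv (nth 0 (c :: s) i) (nth 0 (c :: s) i.+1) g].

(* t_1, ..., t_(k-1) *)
Definition break_points (R : realType) (c : R) (s : seq R) : seq R :=
  behead (belast c s).

(* Only the restriction of g to [c, d] matters. *)
Definition null_curve (R : realType) (n : nat) (f : 'cV[R]_n -> R)
  (c d : R) (g : R -> 'cV[R]_n) : Prop :=
  exists s : seq R,
    piecewise_C1 c d s g /\
    forall t, t \in `[c, d] -> t \notin break_points c s ->
      differentiable f (g t) ->
      bilinear_ker (pullback_metric f (g t)) (derive_within `[c, d] g t).

(* Main.v *)
Require Import Defs.

Set Implicit Arguments.
Unset Strict Implicit.

(** Write [f] for the composite of [sigma] with the row [A], and [F] for
    [f \o gamma].  Two points lie in the same class as soon as [f] takes the
    same value at both, so it is enough that [F] be constant on [[c, d]].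

    Where [f] is nonzero, [A x > a], so [sigma] coincides with the
    differentiable function [h] near [A x] and [f] is differentiable at [x].  At
    such points a kernel vector [v] of the pullback metric satisfies
    [(df v)^2 = 0], hence [df v = 0] ([bilinear_ker_pullback]), and the chain
    rule gives [F'(t) = 0] at every [t] that is not a node of the subdivision and
    has [F t != 0].

    Where [F] vanishes, nothing is known: [sigma] may have a corner at [a], and
    [F] need not be differentiable.  Truncation removes these points.  For
    [w > 0], the function [max (F, w)] is locally constant near the zeros of [F],
    and elsewhere it inherits the zero derivative of [F] because [max (-, w)] is
    1-Lipschitz ([is_derive0_lipschitz]).  So [max (F, w)] is constant on each
    piece by the mean value theorem ([max_constant]), and likewise
    [max (- F, w)].  These truncations, for all [w > 0], determine [F]
    ([eq_from_truncations]).  The argument is made for any continuous [f] that is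
    differentiable off its zero set ([null_curve_constant]). *)

Local Open Scope classical_set_scope.
Local Open Scope ring_scope.

(** * Derivatives *)

(** Equality of the filters, rather than of their limits, turns differentiability
    and derivative relative to [S] into the ordinary ones at an interior point,
    by a single rewriting; in particular the derivatives relative to a piece and to the whole
    interval agree there. *)

Lemma cvg_slope_within (R : realType) (V : normedModType R) (S : set R)
    (g : R -> V) (t : R) : S° t ->
  (fun x => (x - t)^-1 *: (g x - g t)) @ within S t^' =
  (fun h => h^-1 *: ((g \o shift t) (h *: 1) - g t)) @ 0^'.
Proof.
move=> St; apply/funext => P; apply/propext.
pose slope x := (x - t)^-1 *: (g x - g t).
pose slope0 h := h^-1 *: ((g \o shift t) (h *: 1) - g t).
change ((\forall x \near t, x != t -> S x -> P (slope x)) <->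
        (\forall h \near (0 : R), h != 0 -> P (slope0 h))).
rewrite (near_shift 0 t) /= subr0 /slope /slope0; split; last first.
  apply: filterS => h + h0 _; rewrite /= addrK [_%:A]mulr1.
  by apply; rewrite -subr_eq0 addrK in h0.
have St0 : \forall h \near (0 : R), S (h + t).
  move: St.
  change ((\forall x \near t, S x) -> \forall h \near (0 : R), S (h + t)).
  by rewrite (near_shift 0 t) /= subr0.
apply: filterS2 St0 => h Sh + h0; rewrite /= addrK [_%:A]mulr1; apply => //.
by rewrite -subr_eq0 addrK.
Qed.

(** This is not the chain rule, as [phi] need not be differentiable: the
    difference quotients of [phi \o F] are bounded by those of [F], which tend
    to 0. *)
Lemma is_derive0_lipschitz (R : realType) (F phi : R -> R) (t : R) :
  (forall x y, `|phi x - phi y| <= `|x - y|) ->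
  is_derive t 1 F 0 -> is_derive t 1 (phi \o F) 0.
Proof.
move=> phi1 [dF F0].
suff H : h^-1 *: (((phi \o F) \o shift t) (h *: 1) - (phi \o F) t)
    @[h --> (0:R)^'] --> (0 : R).
  by apply: DeriveDef; [apply/cvg_ex; exists 0 | exact: cvg_lim H].
have : h^-1 *: ((F \o shift t) (h *: 1) - F t) @[h --> (0:R)^'] --> 'D_1 F t.
  exact: dF.
rewrite F0 => /cvg_norm; rewrite normr0 => H; apply: norm_cvg0.
apply: (squeeze_cvgr _ (cvg_cst 0) H).
near=> h; rewrite normr_ge0 /= !normrM ler_wpM2l//.
Unshelve. all: by end_near. Qed.

Lemma maxr_lipschitz (R : realType) (v x y : R) :
  `|Num.max x v - Num.max y v| <= `|x - y|.
Proof.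
wlog yx : x y / y <= x.
  move=> H; have [yx|/ltW xy] := leP y x; first exact: H.
  by rewrite distrC (distrC x); exact: H.
have [vx|xv] := leP v x; last first.
  by rewrite [Num.max y v]max_r ?subrr ?normr0 // (le_trans yx) // ltW.
have yM : Num.max y v <= x by rewrite ge_max yx.
rewrite !ger0_norm ?subr_ge0 //.
by rewrite lerB // le_max lexx.
Qed.

(** * Constancy by truncation *)

(** The truncation level [w] is positive so that the zeros of [F], where [F]
    need not be differentiable, lie in the region where the truncation is
    locally constant. *)
Lemma max_constant (R : realType) (u v w : R) (F : R -> R) : 0 < w ->
  {within `[u, v], continuous F} ->
  (forall t, t \in `]u, v[ -> F t != 0 -> is_derive t 1 F 0) ->
  forall t, t \in `[u, v] -> Num.max (F t) w = Num.max (F u) w.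
Proof.
move=> w0 cF dF t /andP[].
rewrite !bnd_simp => ut tv.
have cM : {within `[u, t], continuous (fun s => Num.max (F s) w)}.
  have cFt : {within `[u, t], continuous F}.
    by apply: continuous_subspaceW cF; apply: subset_itvl; rewrite bnd_simp.
  move=> s; apply: (@continuous_max _ (subspace `[u, t]) F (cst w) s).
    exact: cFt.
  exact: cvg_cst.
have dM s : s \in `]u, t[ -> is_derive s 1 (fun s => Num.max (F s) w) 0.
  rewrite in_itv /= => /andP[us st].
  have suv : s \in `]u, v[ by rewrite in_itv /= us (lt_le_trans st).
  have [Fs|Fs] := eqVneq (F s) 0; last first.
    exact: (is_derive0_lipschitz (@maxr_lipschitz _ w) (dF s suv Fs)).
  have cFs : {for s, continuous F}.
    apply: within_continuous_continuous suv => //.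
    exact: lt_le_trans (lt_trans us st) tv.
  have Fw : \forall x \near s, F x < w.
    by apply: (cFs [set y | y < w]); apply: lt_nbhsl; rewrite Fs.
  apply: (near_eq_is_derive (f := cst w)).
  by apply: filterS Fw => x /ltW /max_r.
have [c _ /eqP] := MVT_segment ut dM cM.
by rewrite mul0r subr_eq0 => /eqP.
Qed.

(** If [x < y], they are separated by truncation at a positive level between
    [x] and [y] when [y > 0]; otherwise [- x > 0], and a level between [- y] and
    [- x] separates the opposites. *)
Lemma eq_from_truncations (R : realType) (x y : R) :
  (forall w, 0 < w -> Num.max x w = Num.max y w) ->
  (forall w, 0 < w -> Num.max (- x) w = Num.max (- y) w) -> x = y.
Proof.
wlog : x y / x <= y.
  by move=> H h1 h2; have [xy|/ltW yx] := leP x y; [|apply/esym];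
    apply: H => // w w0; rewrite ?h1 ?h2.
rewrite le_eqVlt => /predU1P[//|xy] h1 h2; exfalso.
have [y0|y0] := ltP 0 y.
  (* [y / 2] keeps the level positive when [x] is not. *)
  have := h1 (Num.max x (y / 2)); rewrite lt_max.
  have y2y : y / 2 < y by rewrite ltr_pdivrMr // ltr_pMr // ltr1n.
  rewrite (max_l (x := y)) ?ge_max ?(ltW xy) ?(ltW y2y) // divr_gt0 ?orbT //.
  rewrite maxA maxxx => /(_ isT) /eqP; apply/negP.
  by rewrite lt_eqF // gt_max xy.
have x0 : x < 0 by exact: lt_le_trans xy y0.
have := h2 (Num.max (- y) (- x / 2)); rewrite lt_max.
have x2x : - x / 2 < - x by rewrite ltr_pdivrMr // ltr_pMr ?ltr1n // oppr_gt0.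
rewrite (maxA (- y) (- y)) maxxx max_l ?ge_max ?lerN2 ?(ltW xy) ?(ltW x2x) //.
rewrite (_ : 0 < - x / 2) ?orbT; last by rewrite divr_gt0 ?oppr_gt0.
move=> /(_ isT) /eqP; apply/negP.
by rewrite gt_eqF // gt_max ltrN2 xy.
Qed.

(** * Subdivisions *)

Lemma constant_on_itv_partition (R : realType) (T : Type) (c d : R)
    (s : seq R) (F : R -> T) :
  itv_partition c d s ->
  (forall i, (i < size s)%N ->
    forall t, t \in `[nth 0 (c :: s) i, nth 0 (c :: s) i.+1] ->
      F t = F (nth 0 (c :: s) i)) ->
  forall t, t \in `[c, d] -> F t = F c.
Proof.
elim: s c => [|x s IH] c.
  move=> /itv_partition_nil <- _ t; rewrite in_itv/= => /andP[h1 h2].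
  by congr F; apply/eqP; rewrite eq_le h1 h2.
move=> cs H t; rewrite in_itv /= => /andP[ct td].
have [tx|/ltW xt] := leP t x.
  by apply: (H 0%N) => //; rewrite in_itv /= ct.
have cx : c <= x by case: cs => /= /andP[/ltW].
rewrite (IH x (itv_partition_cons cs)) ?in_itv /= ?xt //.
  by apply: (H 0%N) => //=; rewrite in_itv /= cx lexx.
by move=> i hi; apply: (H i.+1).
Qed.

Lemma notin_break_points (R : realType) (c d : R) (s : seq R) (i : nat) (t : R) :
  itv_partition c d s -> (i < size s)%N ->
  t \in `]nth 0 (c :: s) i, nth 0 (c :: s) i.+1[ ->
  t \notin break_points c s.
Proof.
move=> [cs _] hi; rewrite in_itv /= => /andP[it ti]; apply/negP.
move=> /mem_behead/mem_belast/(nthP 0)[k ks kt]; move: it ti.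
have srt : sorted <%R (c :: s) by [].
rewrite -kt (lt_sorted_ltn_nth 0 srt) ?inE /= ?ltnS; last 2 first.
- exact: ltnW.
- exact: ks.
move=> ik; rewrite -[nth 0 s i]/(nth 0 (c :: s) i.+1).
by rewrite (lt_sorted_ltn_nth 0 srt) ?inE ?ltnS // leqNgt ik.
Qed.

(** * Null curves *)

(** The form is the square of the differential: pairing [v] with itself gives
    [('d f x v)^2 = 0]. *)
Lemma bilinear_ker_pullback (R : realType) (n : nat) (f : 'cV[R]_n -> R)
    (x v : 'cV[R]_n) : differentiable f x ->
  bilinear_ker (pullback_metric f x) v -> 'd f x v = 0.
Proof.
move=> df kv.
have E : 'd f x v = \sum_i v i 0 * 'D_(delta_mx i 0) f x.
  rewrite {1}[v]matrix_sum_delta linear_sum; apply: eq_bigr => i _.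
  by rewrite big_ord1 linearZ /= -deriveE.
move: (kv v) => /matrixP/(_ 0 0); rewrite !mxE.
under eq_bigr => j _.
  rewrite mxE; under eq_bigr => i _ do rewrite !mxE mulrA.
  rewrite -big_distrl /= -E -mulrA (mulrC _ (v j 0)).
  over.
by rewrite -big_distrr /= -E => /eqP; rewrite mulf_eq0 orbb => /eqP.
Qed.

(** The curve may stay for a whole interval of parameters in the set where [f] is
    not differentiable, where its velocity is unconstrained; but [f] vanishes on
    that set, which is all that [max_constant] requires. *)
Lemma null_curve_constant (R : realType) (n : nat) (f : 'cV[R]_n -> R)
    (c d : R) (gamma : R -> 'cV[R]_n) :
  continuous f -> (forall x, f x != 0 -> differentiable f x) ->
  null_curve f c d gamma ->
  forall t, t \in `[c, d] -> f (gamma t) = f (gamma c).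
Proof.
move=> cf df [s [[cs cg C1g] kg]].
apply: (constant_on_itv_partition (F := f \o gamma) cs) => i hi t ht.
set u := nth _ _ i in ht *; set v := nth _ _ i.+1 in ht.
have cu : c <= u.
  by rewrite /u (set_nth_default d) ?itv_partition_nth_ge //= ltnW.
have vd : v <= d.
  by rewrite /v (set_nth_default d) ?(itv_partition_nth_le _ cs).
have cF : {within `[u, v], continuous (f \o gamma)}.
  have cguv : {within `[u, v], continuous gamma}.
    by apply: continuous_subspaceW cg; apply: subset_itv; rewrite bnd_simp.
  move=> x; apply: (@continuous_comp (subspace `[u, v]) _ _ gamma f x).
    exact: cguv.
  exact: cf.
have dF x : x \in `]u, v[ -> f (gamma x) != 0 -> is_derive x 1 (f \o gamma) 0.
  move=> xuv fx0.
  have xint (S : set R) : `]u, v[ `<=` S -> S° x.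
    move=> uvS; apply: filterS (near_in_itvoo xuv) => y; exact: uvS.
  have uv_int : `[u, v]° x.
    by apply: xint; apply: subset_itv; rewrite bnd_simp.
  have cd_int : `[c, d]° x.
    by apply: xint; apply: subset_itv; rewrite bnd_simp.
  have gx : derivable gamma x 1.
    rewrite /derivable -(cvg_slope_within gamma uv_int); apply: (C1g i hi).1.
    exact: interior_subset uv_int.
  have gE : derive_within `[c, d] gamma x = 'D_1 gamma x.
    by rewrite /derive_within (cvg_slope_within gamma cd_int).
  have dfx := df _ fx0.
  have dg : differentiable gamma x by apply/derivable1_diffP.
  have dfg : differentiable (f \o gamma) x by exact: differentiable_comp.
  apply: DeriveDef; first exact: diff_derivable.
  rewrite deriveE // diff_comp //= -(deriveE (1 : R) dg) -gE.
  apply: bilinear_ker_pullback => //; apply: kg => //.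
    exact: interior_subset cd_int.
  exact: notin_break_points cs hi xuv.
apply: eq_from_truncations => w w0.
  exact: (max_constant w0 cF dF).
apply: (max_constant w0 (u := u) (v := v) (F := fun x => - f (gamma x))) => //.
  by move=> x; apply: cvgN; exact: cF.
move=> x xuv; rewrite oppr_eq0 => /(dF x xuv) dFx.
by rewrite -[0]oppr0; exact: is_deriveN.
Qed.

Unset Implicit Arguments.

Theorem proposition4 (R : realType) (n : nat) (A : 'M[R]_(1, n))
    (sigma : R -> R) (a : R) (h : R -> R) (l : R)
    (c d : R) (gamma : R -> 'cV[R]_n) (p q : 'cV[R]_n) :
  ae_C1 sigma ->
  weakly_monotone sigma ->
  continuous sigma ->
  (forall x : R, sigma x = if x <= a then 0 else h x) ->
  (forall x : R, a < x -> derivable h x 1) ->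
  ((forall x y : R, a < x -> x < y -> h x < h y) \/
   (forall x y : R, a < x -> x < y -> h y < h x)) ->
  h x @[x --> a^'+] --> (0 : R) ->
  derive1 h x @[x --> a^'+] --> l ->
  l != 0 ->
  null_curve (compose_row sigma A) c d gamma ->
  equiv_class (compose_row sigma A) p <> equiv_class (compose_row sigma A) q ->
  ~ ((gamma @` `[c, d]) p /\ (gamma @` `[c, d]) q).
Proof.
move=> _ _ csigma sigmaE dh _ _ _ _ kg pq [[s scd gs] [t tcd gt]].
apply: pq.
set A1 := fun x : 'cV[R]_n => (A *m x) 0 0.
have dA x : differentiable A1 x.
  rewrite (_ : A1 = \sum_j (A 0 j *: (fun x : 'cV[R]_n => x j 0 : R))).
    apply: differentiable_sum => j; apply: differentiableZ.
    exact: differentiable_coord.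
  by apply/funext => y; rewrite /A1 mxE fct_sumE.
have cf : continuous (compose_row sigma A).
  move=> x; apply: (@continuous_comp _ _ _ A1 sigma); last exact: csigma.
  exact: differentiable_continuous.
have df x : compose_row sigma A x != 0 -> differentiable (compose_row sigma A) x.
  rewrite /compose_row sigmaE; case: leP; rewrite ?eqxx // => ax _.
  apply: (@differentiable_comp _ _ _ _ A1 sigma) => //.
  apply/derivable1_diffP; apply: near_eq_derivable (dh _ ax).
  by apply: filterS (lt_nbhsr ax) => y ay; rewrite sigmaE leNgt ay.
have fcst := null_curve_constant cf df kg.
by rewrite /equiv_class -gs -gt !fcst.
Qed.
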